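(* Let $G$ be a finite simple graph on $n$ vertices with spectral radius $\rho=\rho(G)$. Then $\mathcal{E}_{\mathrm{per}}(G)\le n\rho$.
   Context: $\rho(G)$ is the largest absolute value of an eigenvalue of the adjacency matrix $A(G)$. The permanental polynomial is $\pi(G,x)=\operatorname{per}(xI-A(G))$ (where $\operatorname{per}(M)=\sum_{\sigma\in S_n}\prod_i m_{i,\sigma(i)}$), with roots $\mu_1,\dots,\mu_n\in\mathbb{C}$ counted with multiplicity, and the permanental energy is $\mathcal{E}_{\mathrm{per}}(G)=\sum_{i=1}^n|\mu_i|$. *)

(* Defs.v *)
From HB Require Import structures.
From mathcomp Require Import all_boot all_order all_algebra all_fingroup.
From mathcomp Require Import all_classical all_reals.
From mathcomp Require Import complex.

Set Implicit Arguments.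
Unset Strict Implicit.
Unset Printing Implicit Defensive.

Import Order.TTheory GRing.Theory Num.Theory.

Local Open Scope classical_set_scope.
Local Open Scope ring_scope.
Local Open Scope complex_scope.

Definition permanent (R : comNzRingType) (n : nat) (M : 'M[R]_n) : R :=
  \sum_(s : 'S_n) \prod_(i < n) M i (s i).

(* [char_poly_mx A] is the matrix x I - A with polynomial entries. *)
Definition permanental_poly (R : comNzRingType) (n : nat) (A : 'M[R]_n) :
    {poly R} :=
  permanent (char_poly_mx A).

(* The roots of p listed with multiplicity: a sequence r such that
   p = lead_coef p *: \prod_(z <- r) ('X - z%:P). It is unique up to
   permutation when p != 0. *)
Definition roots_mult (F : closedFieldType) (p : {poly F}) : seq F :=
  sval (closed_field_poly_normal p).

Lemma roots_multE (F : closedFieldType) (p : {poly F}) :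
  p = lead_coef p *: \prod_(z <- roots_mult p) ('X - z%:P).
Proof. exact: (svalP (closed_field_poly_normal p)). Qed.

Definition permanental_energy_mx (R : realType) (n : nat) (A : 'M[R[i]]_n) : R :=
  \sum_(z <- roots_mult (permanental_poly A)) ComplexField.Normc.normc z.

(* The set of moduli is finite, so the supremum is a maximum as soon as
   0 < n (see [spectral_radius_mx_max]); for n = 0 it is 0. *)
Definition spectral_radius_mx (R : realType) (n : nat) (A : 'M[R[i]]_n) : R :=
  sup [set ComplexField.Normc.normc z | z in [set z : R[i] | eigenvalue A z]].

Lemma spectral_radius_mx_max (R : realType) (n : nat) (A : 'M[R[i]]_n) :
  (0 < n)%N ->
  (exists2 z, eigenvalue A z &
     ComplexField.Normc.normc z = spectral_radius_mx A) /\
  (forall z, eigenvalue A z ->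
     ComplexField.Normc.normc z <= spectral_radius_mx A).
Proof.
move=> n_gt0; rewrite /spectral_radius_mx; set N := @ComplexField.Normc.normc R.
set r := roots_mult (char_poly A).
have eigr z : eigenvalue A z = (z \in r).
  rewrite eigenvalue_root_char [X in root X _]roots_multE rootZ ?root_prod_XsubC //.
  by rewrite lead_coef_eq0 monic_neq0 // char_poly_monic.
have sz_r : (0 < size r)%N.
  have := size_char_poly A; rewrite {1}(roots_multE (char_poly A)) size_scale.
    by rewrite size_prod_XsubC => -[->].
  by rewrite lead_coef_eq0 monic_neq0 // char_poly_monic.
have [z zr zmax] : exists2 z, z \in r & forall w, w \in r -> N w <= N z.
  elim: (r) sz_r => [//|a s IH _]; have [/size0nil ->|/IH] := posnP (size s).
    by exists a => [|w]; rewrite inE // => /eqP ->.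
  move=> [z zs zmax] {IH}; case: (leP (N a) (N z)) => az.
    exists z => [|w]; first by rewrite inE zs orbT.
    by rewrite inE => /predU1P[->|/zmax].
  exists a => [|w]; first by rewrite inE eqxx.
  by rewrite inE => /predU1P[->//|/zmax wz]; rewrite (le_trans wz) ?ltW.
have -> : sup [set N z | z in [set z : R[i] | eigenvalue A z]] = N z.
  apply/eqP; rewrite eq_le; apply/andP; split.
    apply: ge_sup; first by exists (N z), z; rewrite //= eigr.
    by move=> y [w /=]; rewrite eigr => /zmax wz <-.
  apply: ub_le_sup; last by exists z; rewrite //= eigr.
  by exists (N z) => y [w /=]; rewrite eigr => /zmax wz <-.
by split=> [|w]; [exists z; rewrite ?eigr | rewrite eigr => /zmax].
Qed.

Definition adjacency (R : realType) (V : finType) (E : rel V) :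
    'M[R[i]]_#|V| :=
  \matrix_(i, j) (E (enum_val i) (enum_val j))%:R.

Definition spectral_radius (R : realType) (V : finType) (E : rel V) : R :=
  spectral_radius_mx (adjacency R E).

Definition permanental_energy (R : realType) (V : finType) (E : rel V) : R :=
  permanental_energy_mx (adjacency R E).

(* Main.v *)
(* Every root mu of the permanental polynomial satisfies |mu| <= rho. Since
   the adjacency matrix A is normal, the Rayleigh quotients of A are bounded by
   rho, so for t > rho the symmetric M-matrix t I - A has a positive vector v
   with A v < t v entrywise. If |x| = t, scaling the columns of x I - A by v
   multiplies the permanent by a nonzero constant and makes the matrix strictly
   row diagonally dominant. The permanent of such a matrix, like its
   determinant, does not vanish, so x is not a root. *)

Require Import Defs.
From HB Require Import structures.
From mathcomp Require Import all_boot all_order all_algebra all_fingroup.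
From mathcomp Require Import all_classical all_reals.
From mathcomp Require Import complex.
From mathcomp Require Import spectral.

Set Implicit Arguments.
Unset Strict Implicit.
Unset Printing Implicit Defensive.

Import Order.TTheory GRing.Theory Num.Theory.

Local Open Scope ring_scope.

(** * Permanents: cofactors and column operations *)

(** This is the permanent of the minor without row [i0] and column [j], written as a sum over
    permutations so that the dimension stays [n]. *)
Definition per_cofactor (R : comNzRingType) (n : nat) (M : 'M[R]_n)
    (i0 j : 'I_n) : R :=
  \sum_(s : 'S_n | s i0 == j) \prod_(i < n | i != i0) M i (s i).

Lemma expand_permanent_row (R : comNzRingType) (n : nat) (M : 'M[R]_n)
    (i0 : 'I_n) :
  permanent M = \sum_j M i0 j * per_cofactor M i0 j.
Proof.
rewrite /permanent (partition_big (fun s : 'S_n => s i0) xpredT) //=.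
apply: eq_bigr => j _; rewrite mulr_sumr; apply: eq_bigr => s /eqP <-.
by rewrite (bigD1 i0).
Qed.

Lemma permanent_unit_row (R : comNzRingType) (n : nat) (M : 'M[R]_n)
    (i0 : 'I_n) :
  (forall j, M i0 j = (i0 == j)%:R) -> permanent M = per_cofactor M i0 i0.
Proof.
move=> M0; rewrite (expand_permanent_row _ i0) (bigD1 i0) //= M0 eqxx mul1r.
rewrite big1 ?addr0 // => j ji0.
by rewrite M0 eq_sym (negbTE ji0) mul0r.
Qed.

Lemma permanent1 (R : comNzRingType) (n : nat) :
  permanent (1%:M : 'M[R]_n) = 1.
Proof.
rewrite /permanent (bigD1 1%g) //= big1 => [|i _]; last by rewrite mxE perm1 eqxx.
rewrite big1 ?addr0 // => s s1; case: (pickP (fun i => s i != i)) => [i si|sid].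
  by rewrite (bigD1 i) //= mxE eq_sym (negbTE si) mul0r.
case/eqP: s1; apply/permP => i; rewrite perm1.
by apply/eqP/negbFE/sid.
Qed.

Lemma permanent_scale_cols (R : comNzRingType) (n : nat) (M : 'M[R]_n)
    (v : 'I_n -> R) :
  permanent (\matrix_(i, j) (M i j * v j)) = permanent M * \prod_i v i.
Proof.
rewrite /permanent mulr_suml; apply: eq_bigr => s _.
rewrite (eq_bigr (fun i => M i (s i) * v (s i))) => [|i _]; last by rewrite mxE.
by rewrite big_split /= [X in _ = _ * X](reindex_inj (@perm_inj _ s)).
Qed.

(** Realises the cofactor at [(i0, i0)] as the permanent of an [n] by [n] matrix with row [i0] made
    a unit row. *)
Definition replace_unit_row (R : comNzRingType) (n : nat) (M : 'M[R]_n)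
    (i0 : 'I_n) : 'M[R]_n :=
  \matrix_(i, k) (if i == i0 then (i == k)%:R else M i k).

Lemma permanent_replace_unit_row (R : comNzRingType) (n : nat) (M : 'M[R]_n)
    (i0 : 'I_n) :
  permanent (replace_unit_row M i0) = per_cofactor M i0 i0.
Proof.
rewrite (@permanent_unit_row _ _ _ i0) => [|j]; last by rewrite mxE eqxx.
apply: eq_bigr => s _; apply: eq_bigr => i ii0.
by rewrite mxE (negbTE ii0).
Qed.

Definition merge_col (R : comNzRingType) (n : nat) (M : 'M[R]_n)
    (i0 j : 'I_n) (t : R) : 'M[R]_n :=
  \matrix_(i, k) (if i == i0 then (i == k)%:R
                  else if k == i0 then 0
                  else if k == j then M i j + t * M i i0 else M i k).

(* Exchanging the columns [i0] and [j] turns the permutations with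
   [s i0 = i0] into those with [s i0 = j]. *)
Lemma permanent_merge_col (R : comNzRingType) (n : nat) (M : 'M[R]_n)
    (i0 j : 'I_n) (t : R) : j != i0 ->
  permanent (merge_col M i0 j t) = per_cofactor M i0 i0 + t * per_cofactor M i0 j.
Proof.
move=> ji0.
rewrite (@permanent_unit_row _ _ _ i0) => [|k]; last by rewrite mxE eqxx.
rewrite [X in _ = _ + t * X]/per_cofactor (reindex_inj (mulIg (tperm i0 j))) /=.
rewrite (eq_bigl (fun s : 'S_n => s i0 == i0)); last first.
  by move=> s; rewrite permM -{2}(tpermL i0 j) (inj_eq perm_inj).
rewrite mulr_sumr -big_split /=; apply: eq_bigr => s /eqP si0.
(* Apart from [i0], only row [i1] sees the transposition; its merged entry splits into the two
   required terms. *)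
pose i1 := (s^-1)%g j.
have si1 : s i1 = j by rewrite permKV.
have i10 : i1 != i0 by apply: contra_neq ji0 => i1E; rewrite -si1 i1E.
rewrite !(bigD1 i1 i10) /= mxE (negbTE i10) permM si1 (negbTE ji0) eqxx tpermR.
have off i : (i != i0) && (i != i1) -> (s i != i0) && (s i != j).
  case/andP=> ii0 ii1; rewrite -{1}si0 -{1}si1 !(inj_eq perm_inj).
  by rewrite ii0.
rewrite (eq_bigr (fun i => M i (s i))); last first.
  move=> i ii; have /andP[a b] := off i ii; case/andP: ii => ii0 ii1.
  by rewrite mxE (negbTE ii0) (negbTE a) (negbTE b).
rewrite [X in t * (_ * X)](eq_bigr (fun i => M i (s i))); last first.
  move=> i ii; have /andP[a b] := off i ii.
  by rewrite permM tpermD // eq_sym.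
by rewrite mulrDl mulrA.
Qed.

(** * Diagonal dominance and nonvanishing permanents *)

Definition row_dominant (F : numFieldType) (n : nat) (M : 'M[F]_n) : Prop :=
  forall i, \sum_(j < n | j != i) `|M i j| < `|M i i|.

Lemma unit_row_dominant (F : numFieldType) (n : nat) (M : 'M[F]_n) (i : 'I_n) :
  (forall j, M i j = (i == j)%:R) -> \sum_(j < n | j != i) `|M i j| < `|M i i|.
Proof.
move=> Mi; rewrite Mi eqxx normr1 big1 ?ltr01 // => j ji.
by rewrite Mi eq_sym (negbTE ji) normr0.
Qed.

Lemma replace_unit_row_dominant (F : numFieldType) (n : nat) (M : 'M[F]_n)
    (i0 : 'I_n) :
  row_dominant M -> row_dominant (replace_unit_row M i0).
Proof.
move=> domM i; have [->|ii0] := eqVneq i i0.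
  by apply: unit_row_dominant => j; rewrite mxE eqxx.
rewrite mxE (negbTE ii0); under eq_bigr do rewrite mxE (negbTE ii0).
exact: domM.
Qed.

(** In a row other than [i0], the entry [M i i0] leaves column [i0], which frees [|M i i0|]. As
    [|t| <= 1], this pays for the growth of the entry in column [j], or for the loss on the diagonal
    when [i = j]. *)
Lemma merge_col_dominant (F : numFieldType) (n : nat) (M : 'M[F]_n)
    (i0 j : 'I_n) (t : F) : j != i0 -> `|t| <= 1 ->
  row_dominant M -> row_dominant (merge_col M i0 j t).
Proof.
move=> ji0 t1 domM i; have [->|ii0] := eqVneq i i0.
  by apply: unit_row_dominant => k; rewrite mxE eqxx.
have tM : `|t * M i i0| <= `|M i i0| by rewrite normrM ler_piMl.
have := domM i; have i0i : i0 != i by rewrite eq_sym.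
rewrite !(bigD1 i0 i0i) /= ![merge_col _ _ _ _ _ _]mxE (negbTE ii0) eqxx normr0 add0r.
have [eij|ij] := eqVneq i j.
  move=> dom; rewrite -eij.
  apply: lt_le_trans (_ : `|M i i| - `|M i i0| <= _).
    rewrite ltrBrDl; apply: le_lt_trans dom; rewrite lerD2l.
    apply: ler_sum => k /andP[ki ki0].
    by rewrite mxE (negbTE ii0) (negbTE ki0) (negbTE ki).
  by apply: le_trans (lerB_normD _ _); rewrite lerB.
have jC : (j != i) && (j != i0) by rewrite ji0 eq_sym ij.
rewrite !(bigD1 j jC) /= ![merge_col _ _ _ _ _ _]mxE (negbTE ii0) (negbTE ji0) eqxx.
apply: le_lt_trans; rewrite addrA lerD //.
  by rewrite addrC; apply: le_trans (ler_normD _ _) _; rewrite lerD2l.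
apply: ler_sum => k /andP[/andP[ki ki0] kj].
by rewrite mxE (negbTE ii0) (negbTE ki0) (negbTE kj).
Qed.

(* The induction is on the number of rows that are not unit vectors: a
   Laplace expansion along such a row [i0] reduces the claim to the cofactors
   [c j], and the inequality [`|c j| < `|c i0|] holds because the permanent
   [c i0 + t * c j] of a merged matrix is nonzero whenever [`|t| <= 1]. *)
Lemma row_dominant_permanent_neq0 (F : numFieldType) (n : nat) (M : 'M[F]_n) :
  row_dominant M -> permanent M != 0.
Proof.
suff H k : forall M : 'M[F]_n,
    (forall i j : 'I_n, (k <= i)%N -> M i j = (i == j)%:R) ->
    row_dominant M -> permanent M != 0.
  by apply: (H n) => i j; rewrite leqNgt ltn_ord.
elim: k => [|k IHk] {}M unitM domM.
  suff -> : M = 1%:M by rewrite permanent1 oner_neq0.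
  by apply/matrixP => i j; rewrite unitM // mxE.
have [kn|nk] := ltnP k n; last first.
  by apply: IHk domM => i j /(leq_trans nk); rewrite leqNgt ltn_ord.
pose i0 := Ordinal kn; pose c := per_cofactor M i0.
have kP (i : 'I_n) : (k <= i)%N -> i != i0 -> (k < i)%N.
  by move=> ki ii0; rewrite ltn_neqAle ki andbT eq_sym.
have c0 : c i0 != 0.
  rewrite /c -permanent_replace_unit_row; apply: IHk; last first.
    exact: replace_unit_row_dominant.
  move=> i j ki; rewrite mxE; case: (eqVneq i i0) => [//|/(kP _ ki)].
  exact: unitM.
have c0j j : j != i0 -> `|c j| < `|c i0|.
  move=> ji0; rewrite real_ltNge ?normr_real //; apply/negP => le_c.
  have cj0 : c j != 0.
    by rewrite -normr_gt0 (lt_le_trans _ le_c) // normr_gt0.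
  (* This [t] makes [c i0 + t * c j] vanish, and [|t| <= 1] is the assumption [|c i0| <= |c j|]. *)
  pose t := - c i0 / c j.
  have t1 : `|t| <= 1.
    by rewrite normrM normrN normfV ler_pdivrMr ?normr_gt0 // mul1r.
  have : permanent (merge_col M i0 j t) != 0.
    apply: IHk; last exact: merge_col_dominant.
    move=> i l ki; rewrite mxE; case: (eqVneq i i0) => [//|ii0].
    have Mi m := unitM i m (kP _ ki ii0); rewrite !Mi (negbTE ii0) mulr0 addr0.
    case: (eqVneq l i0) => [->|_]; first by rewrite (negbTE ii0).
    by case: (eqVneq l j) => [->|].
  by rewrite permanent_merge_col // -/(c _) -/(c j) divfK // subrr eqxx.
rewrite (expand_permanent_row _ i0) (bigD1 i0) //= -/(c i0) -normr_gt0.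
apply: lt_le_trans (lerB_normD _ _); rewrite subr_gt0 normrM.
apply: le_lt_trans (ler_norm_sum _ _ _) _.
(* The strict inequality comes from the dominance of row [i0], multiplied by [|c i0| > 0]. *)
apply: le_lt_trans (_ : (\sum_(j < n | j != i0) `|M i0 j|) * `|c i0| < _).
  rewrite mulr_suml; apply: ler_sum => j ji0.
  by rewrite normrM ler_wpM2l // ltW // c0j.
by rewrite ltr_pM2r ?normr_gt0.
Qed.

(** * Rayleigh quotients *)

Section Rayleigh.
Local Open Scope sesquilinear_scope.

(** Row [k] of the unitary diagonalising matrix is a left eigenvector, nonzero because that matrix
    is invertible. *)
Lemma spectral_diag_eigenvalue (C : numClosedFieldType) (n : nat) (A : 'M[C]_n)
    (k : 'I_n) :
  A \is normalmx -> eigenvalue A (spectral_diag A 0 k).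
Proof.
move=> /orthomx_spectralP AE; set P := spectralmx A in AE *.
set d := spectral_diag A in AE *.
have PA : P *m A = diag_mx d *m P by rewrite {1}AE !mulmxA mulmxV ?spectral_unit ?mul1mx.
apply/eigenvalueP; exists (row k P).
  by rewrite -row_mul PA row_mul row_diag_mx -scalemxAl -rowE.
apply/eqP => Pk0; have : row k (P *m invmx P) = 0 by rewrite row_mul Pk0 mul0mx.
rewrite mulmxV ?spectral_unit // => /matrixP/(_ 0 k)/eqP.
by rewrite !mxE eqxx oner_eq0.
Qed.

(** In the unitary eigenbasis the form is the sum of [d k * |z k| ^+ 2], while the squared norm is
    the sum of [|z k| ^+ 2]. *)
Lemma normal_rayleigh_le (C : numClosedFieldType) (n : nat) (A : 'M[C]_n)
    (r : C) (y : 'rV[C]_n) : A \is normalmx ->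
  (forall a, eigenvalue A a -> `|a| <= r) ->
  `|(y *m A *m y ^t*) 0 0| <= r * (y *m y ^t*) 0 0.
Proof.
move=> nA rP; have /orthomx_spectralP AE := nA.
have uP := spectral_unitarymx A.
set P := spectralmx A in AE uP *; set d := spectral_diag A in AE.
pose z := y *m P ^t*.
have zC : z ^t* = P *m y ^t* by rewrite trmx_mul map_mxM trmxCK.
have -> : y *m A *m y ^t* = z *m diag_mx d *m z ^t*.
  by rewrite zC {1}AE invmx_unitary // !mulmxA.
have -> : y *m y ^t* = z *m z ^t*.
  by rewrite zC /z -invmx_unitary // mulmxA mulmxKV // unitarymx_unit.
rewrite !mxE mulr_sumr; apply: le_trans (ler_norm_sum _ _ _) _.
apply: ler_sum => k _; rewrite mul_mx_diag !mxE -normCK mulrAC -normCK normrM normrX.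
rewrite normr_id mulrC ler_wpM2r ?exprn_ge0 //.
exact/rP/spectral_diag_eigenvalue.
Qed.

Lemma normCE (R : realType) (z : R[i]) :
  `|z| = real_complex R (ComplexField.Normc.normc z).
Proof. by []. Qed.

(** A real symmetric matrix is Hermitian over the complex numbers, hence normal. *)
Lemma symmetric_rayleigh_le (R : realType) (n : nat) (B : 'M[R]_n)
    (u : 'I_n -> R) : (0 < n)%N -> (forall i j, B i j = B j i) ->
  \sum_i \sum_j u i * B i j * u j <=
  spectral_radius_mx (map_mx (real_complex R) B) * \sum_i u i ^+ 2.
Proof.
move=> n_gt0 symB; set A := map_mx _ B.
have [_ radA] := spectral_radius_mx_max A n_gt0.
pose y : 'rV[R[i]]_n := \row_i real_complex R (u i).
have conjR (x : R) : (real_complex R x)^* = real_complex R x.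
  by apply/eqP; rewrite eq_complex /= oppr0 !eqxx.
have nA : A \is normalmx.
  apply/normalmxP; suff -> : A ^t* = A by [].
  by apply/matrixP => i j; rewrite !mxE symB conjR.
have rP a : eigenvalue A a -> `|a| <= real_complex R (spectral_radius_mx A).
  by move=> /radA; rewrite normCE lecR.
have := normal_rayleigh_le y nA rP.
have -> : (y *m A *m y ^t*) 0 0 =
    real_complex R (\sum_i \sum_j u i * B i j * u j).
  rewrite exchange_big /= mxE rmorph_sum; apply: eq_bigr => j _ /=.
  rewrite !mxE conjR mulr_suml rmorph_sum; apply: eq_bigr => i _ /=.
  by rewrite !mxE !rmorphM.
have -> : (y *m y ^t*) 0 0 = real_complex R (\sum_i u i ^+ 2).
  rewrite mxE rmorph_sum; apply: eq_bigr => j _ /=.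
  by rewrite !mxE conjR rmorphXn expr2.
rewrite -rmorphM => le; rewrite -lecR.
(* The form takes a real value, which is at most its modulus. *)
apply: le_trans le; apply: real_ler_norm.
by rewrite realE -[0]/(real_complex R 0) !lecR le_total.
Qed.

End Rayleigh.

(** * A positive subinvariant vector *)

(* [w = 1 (t I - B)^-1] works: pairing [w (t I - B) = 1] with the negative
   part [q] of [w] gives [\sum q <= (r - t) * \sum q ^+ 2], hence [q = 0]. *)
Lemma exists_subinvariant_vector (R : realFieldType) (n : nat) (B : 'M[R]_n)
    (r t : R) :
  (forall i j, B i j = B j i) -> (forall i j, 0 <= B i j) ->
  (forall u : 'I_n -> R,
     \sum_i \sum_j u i * B i j * u j <= r * \sum_i u i ^+ 2) ->
  r < t ->
  exists2 v : 'I_n -> R, (forall i, 0 < v i) &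
    forall i, \sum_j B i j * v j < t * v i.
Proof.
move=> symB B0 ray rt; set T := t%:M - B.
have TE (w : 'rV[R]_n) i : (w *m T) 0 i = t * w 0 i - \sum_j B i j * w 0 j.
  rewrite mulmxBr mul_mx_scalar !mxE; congr (_ - _).
  by apply: eq_bigr => j _; rewrite symB mulrC.
(* Serves twice: for a kernel vector of [T], to invert [T], and for the negative part [q]. *)
have sq0 (u : 'I_n -> R) : t * (\sum_i u i ^+ 2) <= r * (\sum_i u i ^+ 2) ->
    forall i, u i = 0.
  rewrite -subr_ge0 -mulrBl nmulr_rge0 ?subr_lt0 // => le0 i.
  have : \sum_i u i ^+ 2 = 0.
    by apply/eqP; rewrite eq_le le0 sumr_ge0 // => j _; exact: sqr_ge0.
  move=> /eqP; rewrite psumr_eq0 => [|j _]; last exact: sqr_ge0.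
  by move=> /allP/(_ i (mem_index_enum _)); rewrite sqrf_eq0 => /eqP.
have unitT : T \in unitmx.
  rewrite -row_free_unit -kermx_eq0; apply/rowV0P => w /sub_kermxP wT0.
  apply/rowP => i; rewrite [RHS]mxE; apply: (sq0 (fun i => w 0 i)).
  apply: le_trans (ray _); rewrite mulr_sumr le_eqVlt; apply/orP; left.
  apply/eqP/eq_bigr => {}i _; have /rowP/(_ i) := wT0; rewrite TE mxE.
  move=> /eqP; rewrite subr_eq0 => /eqP tw.
  rewrite expr2 mulrA tw mulr_suml; apply: eq_bigr => j _.
  by rewrite [in LHS]mulrC mulrA.
pose w : 'rV[R]_n := const_mx 1 *m invmx T.
have wE i : t * w 0 i - \sum_j B i j * w 0 j = 1.
  by rewrite -TE mulmxKV // mxE.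
pose q i := Num.max (- w 0 i) 0.
have q0 i : 0 <= q i by rewrite le_max lexx orbT.
have qw i : - q i <= w 0 i by rewrite lerNl le_max lexx.
have qE i : q i * w 0 i = - q i ^+ 2.
  rewrite /q; case: (leP (- w 0 i) 0) => _; first by rewrite mul0r expr0n oppr0.
  by rewrite sqrrN expr2 mulNr.
have qz : forall i, q i = 0.
  apply: sq0; apply: le_trans (ray _).
  rewrite -subr_ge0.
  (* Replace the factor 1 by [wE i]: then [q i * w i = - q i ^+ 2], and [- w j <= q j] bounds the
     remaining terms by the form of [B] at [q]. *)
  apply: le_trans (_ : \sum_i q i * 1 <= _); first by apply: sumr_ge0 => i _; rewrite mulr1.
  rewrite mulr_sumr -sumrB; apply: ler_sum => i _.
  rewrite -[in X in X <= _](wE i) mulrBr mulrCA qE mulrN [leLHS]addrC lerD2r.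
  rewrite mulr_sumr -sumrN; apply: ler_sum => j _.
  rewrite mulrA -mulrN ler_wpM2l ?mulr_ge0 //.
  by rewrite lerNl.
have w_ge0 i : 0 <= w 0 i by rewrite (le_trans _ (qw i)) // qz oppr0.
have Bw i : \sum_j B i j * w 0 j = t * w 0 i - 1 by rewrite -(wE i) opprB addrC subrK.
exists (fun i => w 0 i) => i; last by rewrite Bw ltrBlDr ltrDl.
(* A zero entry of [w] would turn [wE i] into [1 + \sum_j B i j * w j = 0], a sum that is
   positive. *)
rewrite lt0r w_ge0 andbT; apply/eqP => w0; have := wE i.
rewrite w0 mulr0 sub0r => /eqP; rewrite eq_sym -subr_eq0 opprK => /eqP s0.
have : 0 < 1 + \sum_j B i j * w 0 j.
  by rewrite ltr_pwDl // sumr_ge0 // => j _; rewrite mulr_ge0.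
by rewrite s0 ltxx.
Qed.

(** Take [t = |z|]. As [B] has zero diagonal, [B v < |z| v] is exactly row dominance of [M] with
    columns scaled by [v]. *)
Lemma permanent_sub_scalar_neq0 (R : realType) (n : nat) (B : 'M[R]_n)
    (z : R[i]) : (0 < n)%N ->
  (forall i j, B i j = B j i) -> (forall i j, 0 <= B i j) ->
  (forall i, B i i = 0) ->
  spectral_radius_mx (map_mx (real_complex R) B) < ComplexField.Normc.normc z ->
  permanent (z%:M - map_mx (real_complex R) B) != 0.
Proof.
move=> n_gt0 symB B0 Bd zr; set M := _ - _.
have [v v0 vP] := exists_subinvariant_vector symB B0
  (fun u => symmetric_rayleigh_le u n_gt0 symB) zr.
have normv i : `|real_complex R (v i)| = real_complex R (v i).
  by rewrite ger0_norm // lecR ltW.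
have /row_dominant_permanent_neq0 :
    row_dominant (\matrix_(i, j) (M i j * real_complex R (v j))).
  move=> i; rewrite !mxE eqxx mulr1n Bd rmorph0 subr0 normrM normCE normv.
  rewrite -rmorphM (eq_bigr (fun j => real_complex R (B i j * v j))) => [|j ji].
    rewrite -rmorph_sum ltcR; apply: le_lt_trans (vP i).
    by rewrite [leRHS](bigD1 i) //= Bd mul0r add0r.
  rewrite !mxE eq_sym (negbTE ji) mulr0n sub0r normrM normrN normv rmorphM.
  by rewrite [`|_|]ger0_norm // lecR.
by rewrite permanent_scale_cols mulf_eq0 negb_or => /andP[].
Qed.

(** * Degree and roots of the permanental polynomial *)

Lemma horner_permanental_poly (R : comNzRingType) (n : nat) (A : 'M[R]_n) (z : R) :
  (permanental_poly A).[z] = permanent (z%:M - A).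
Proof.
rewrite /permanental_poly /permanent horner_sum; apply: eq_bigr => s _.
rewrite horner_prod; apply: eq_bigr => i _.
by rewrite !mxE hornerD hornerN hornerMn hornerX hornerC.
Qed.

Lemma size_permanental_poly_le (R : comNzRingType) (n : nat) (A : 'M[R]_n) :
  (size (permanental_poly A) <= n.+1)%N.
Proof.
apply: (leq_trans (size_sum _ _ _)); apply/bigmax_leqP => s _.
apply: (leq_trans (size_poly_prod_leq _ _)).
(* Sizes exceed degrees by one: a sum of at most [2n] gives a product of size at most
   [2n + 1 - n]. *)
have : (\sum_(i < n) size (char_poly_mx A i (s i)) <= n * 2)%N.
  rewrite -[X in (_ <= X * 2)%N]card_ord -sum_nat_const; apply: leq_sum => i _.
  rewrite !mxE; case: (i == s i); first by rewrite mulr1n size_XsubC.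
  by rewrite mulr0n sub0r size_polyN (leq_trans (size_polyC_leq1 _)).
rewrite muln2 -addnn leq_subLR cardE size_enum_ord addnS ltnS //.
Qed.

Lemma size_roots_mult (F : closedFieldType) (p : {poly F}) :
  p != 0 -> size p = (size (roots_mult p)).+1.
Proof.
move=> p0; rewrite {1}(roots_multE p) size_scale ?lead_coef_eq0 //.
exact: size_prod_XsubC.
Qed.

Lemma root_roots_mult (F : closedFieldType) (p : {poly F}) (z : F) :
  z \in roots_mult p -> root p z.
Proof.
move=> zr; rewrite [X in root X](roots_multE p) rootE hornerZ.
by have := root_prod_XsubC (roots_mult p) z; rewrite zr rootE => /eqP ->; rewrite mulr0.
Qed.

Theorem theorem3p5 (R : realType) (V : finType) (E : rel V)
    (symE : symmetric E) (irrE : irreflexive E) (n : nat) (cardV : #|V| = n) :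
  permanental_energy R E <= n%:R * spectral_radius R E.
Proof.
pose B : 'M[R]_#|V| := \matrix_(i, j) (E (enum_val i) (enum_val j))%:R.
have AE : adjacency R E = map_mx (real_complex R) B.
  by apply/matrixP => i j; rewrite !mxE rmorph_nat.
have per0 z : (0 < #|V|)%N ->
    spectral_radius R E < ComplexField.Normc.normc z ->
    (permanental_poly (adjacency R E)).[z] != 0.
  move=> V0; rewrite /spectral_radius horner_permanental_poly AE.
  apply: permanent_sub_scalar_neq0 => // [i j|i j|i]; rewrite !mxE ?ler0n //.
    by rewrite symE.
  by rewrite irrE.
rewrite /permanental_energy /permanental_energy_mx.
set p := permanental_poly _ in per0 *.
(* On the empty graph the permanent is 1, so there are no roots and both sides are 0. *)
have [V0|V0] := posnP #|V|.
  have p1 : size p = 1%N.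
    have -> : p = 1; last exact: size_poly1.
    rewrite /p /permanental_poly.
    rewrite (_ : char_poly_mx _ = 1%:M) ?permanent1 //.
    by apply/matrixP => i; have := leq_trans (ltn_ord i) (eq_leq V0).
  have p_neq0 : p != 0 by rewrite -size_poly_eq0 p1.
  have := size_roots_mult p_neq0; rewrite p1 => -[/esym/size0nil ->].
  by rewrite big_nil -cardV V0 mul0r.
have [[a _ aE] _] := spectral_radius_mx_max (adjacency R E) V0.
have rho_ge0 : 0 <= spectral_radius R E.
  by rewrite /spectral_radius -aE; case: (a) => ? ?; exact: sqrtr_ge0.
(* The value at the spectral radius plus 1 is nonzero by [per0]. *)
have p_neq0 : p != 0.
  have : ComplexField.Normc.normc (real_complex R (spectral_radius R E + 1)) =
      spectral_radius R E + 1.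
    by rewrite /= expr0n addr0 sqrtr_sqr ger0_norm // addr_ge0.
  move=> nE; have := per0 (real_complex R (spectral_radius R E + 1)) V0.
  rewrite nE ltrDl ltr01 => /(_ isT); apply: contra_neq => ->.
  by rewrite horner0.
apply: le_trans (_ : \sum_(z <- roots_mult p) spectral_radius R E <= _).
  rewrite big_seq [leRHS]big_seq; apply: ler_sum => z /root_roots_mult pz.
  by rewrite leNgt; apply/negP => /(per0 z V0)/negP; apply.
rewrite big_const_seq count_predT iter_addr_0 -[leLHS]mulr_natl ler_wpM2r //.
(* The number of roots is one less than the size of [p], hence at most [n]. *)
rewrite ler_nat -ltnS -size_roots_mult // -cardV.
exact: size_permanental_poly_le.
Qed.
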